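(* Let $\mathcal{G}$ be a connected compact finite metric graph which is not a loop graph (that is, not homeomorphic to a circle), let $D$ be a subset of its pendant vertices, and let $L=L(\mathcal{G},D)$ be the graph Laplacian with Dirichlet conditions at the vertices of $D$ and standard (continuity and Kirchhoff) conditions at all other vertices. Let $\mathcal{D}=|D|$, let $\mathcal{N}$ be the number of pendant vertices not in $D$, and let $\beta$ be the first Betti number of $\mathcal{G}$. Then the multiplicity of any eigenvalue of $L$ is at most $\mathcal{D}+\mathcal{N}+2\beta-1$.
   Context: A compact finite metric graph $\mathcal{G}$ is the quotient of a disjoint union of finitely many compact intervals of positive length (edges) $e_i=[x_{2i-1},x_{2i}]$ by an equivalence relation on the set of endpoints; the equivalence classes are the vertices. Loops and multiple edges are allowed. The degree of a vertex is the number of interval endpoints in its class; a pendant vertex is a vertex of degree one. The first Betti number is $\beta=|E|-|V|+1$. The Laplacian $L(\mathcal{G},D)$ acts as $-\frac{d^2}{dx^2}$ on each edge, on functions $f\in\bigoplus_i H^2[x_{2i-1},x_{2i}]$ that are continuous on $\mathcal{G}$, satisfy $f(v)=0$ for all $v\in D$, and satisfy the Kirchhoff condition $\sum_{x_j\in v}\partial f(x_j)=0$ at every vertex $v\notin D$, where $\partial f(x_{2i-1})=f'(x_{2i-1})$ and $\partial f(x_{2i})=-f'(x_{2i})$. At a pendant vertex not in $D$ this is the Neumann condition. $L(\mathcal{G},D)$ is self-adjoint in $L_2(\mathcal{G})=\bigoplus_i L_2[x_{2i-1},x_{2i}]$ with discrete spectrum. *)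

(* Defs.v *)
From HB Require Import structures.
From mathcomp Require Import all_boot all_order all_algebra.
From mathcomp Require Import generic_quotient complex.
From mathcomp Require Import all_classical all_reals all_analysis.

Set Implicit Arguments.
Unset Strict Implicit.
Unset Printing Implicit Defensive.

Import Order.TTheory GRing.Theory Num.Theory.
Import numFieldNormedType.Exports.

Local Open Scope classical_set_scope.
Local Open Scope ring_scope.
Local Open Scope complex_scope.
Local Open Scope quotient_scope.

(* The edge [e] is the interval [[endpt e false, endpt e true]]: the pair
   [(e, false)] names its left endpoint and [(e, true)] its right one.  The
   equivalence [vrel] acts on these names and not on the real numbers, since
   the intervals are disjoint only by convention. *)
Record metricGraph (R : realType) := MetricGraph {
  edge : finType;
  endpt : edge -> bool -> R;
  endpt_lt : forall e, endpt e false < endpt e true;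
  vrel : rel (edge * bool);
  vrel_equiv : equivalence_rel vrel
}.

Arguments vrel {R} G _ _ : rename.

Section Combinatorics.
Variables (R : realType) (G : metricGraph R).

Definition endpoint : finType := (edge G * bool)%type.

Definition vertices : {set {set endpoint}} :=
  equivalence_partition (vrel G) [set: endpoint]%SET.

Definition degree (v : {set endpoint}) : nat := #|v|.

Definition pendant : {set {set endpoint}} :=
  [set v in vertices | degree v == 1%N]%SET.

Definition betti : int := #|edge G|%:Z - #|vertices|%:Z + 1.

End Combinatorics.

Section Space.
Variables (R : realType) (G : metricGraph R).

Definition edge_set (e : edge G) : set R := `[endpt e false, endpt e true].

Definition edge_space (e : edge G) : topologicalType := set_type (edge_set e).

Definition edges_space : topologicalType := {e : edge G & edge_space e}.

Lemma endpt_in (s : endpoint G) : endpt s.1 s.2 \in edge_set s.1.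
Proof.
by case: s => e [] /=; rewrite inE /edge_set /= in_itv /= lexx ltW ?endpt_lt.
Qed.

Definition endpoint_pt (s : endpoint G) : edges_space :=
  existT (fun e => edge_space e) s.1 (SigSub (endpt_in s)).

Lemma endpoint_pt_inj : injective endpoint_pt.
Proof.
move=> [e b] [e' b'] h.
have ee' : e = e' by exact: (congr1 (@projT1 _ _) h).
move: h; rewrite -{}ee' => h; congr (_, _).
have {h} : endpt e b = endpt e b'.
  have /= := congr1 (fun p : edges_space => set_val (projT2 p)) h.
  by rewrite !set_valE.
have := endpt_lt e.
by case: b b' => [] [] // + h; rewrite h ltxx.
Qed.

Definition glue (p q : edges_space) : Prop :=
  p = q \/ exists s t, [/\ p = endpoint_pt s, q = endpoint_pt t & vrel G s t].

Lemma glue_equiv : equiv_class_of (fun p q => `[< glue p q >]).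
Proof.
have vrr s : vrel G s s by have [] := @vrel_equiv R G s s s.
have vrlr s t u : vrel G s t -> vrel G s u = vrel G t u.
  by have [] := @vrel_equiv R G s t u.
have vsym s t : vrel G s t -> vrel G t s by move=> st; rewrite -(vrlr _ _ s st).
have gsym p q : glue p q -> glue q p.
  case=> [->|[s [t [-> -> st]]]]; first by left.
  by right; exists t, s; split => //; exact: vsym.
split=> [p|p q|q p r].
- by apply/asboolP; left.
- by apply/asboolP/asboolP; exact: gsym.
move=> /asboolP[->//|[s [t [-> -> st]]]] /asboolP[<-|[t' [u [+ -> tu]]]].
  by apply/asboolP; right; exists s, t.
move=> /endpoint_pt_inj tt'; apply/asboolP; right; exists s, u; split => //.
by rewrite (vrlr _ _ _ st) tt'.
Qed.

Canonical glue_rel := EquivRelPack glue_equiv.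

Definition graph_space : topologicalType :=
  quotient_topology {eq_quot glue_rel}.

End Space.

Definition homeomorphic (T U : topologicalType) : Prop :=
  exists (f : T -> U) (g : U -> T),
    [/\ cancel f g, cancel g f, continuous f & continuous g].

Definition circle (R : realType) : topologicalType :=
  set_type [set z : R * R | z.1 ^+ 2 + z.2 ^+ 2 = 1].

Section Sobolev.
Variable R : realType.
Local Notation mu := (@lebesgue_measure R).

Definition cintegral (a b : R) (f : R -> R[i]) : R[i] :=
  (\int[mu]_(t in `[a, b]) complex.Re (f t)) +i*
  (\int[mu]_(t in `[a, b]) complex.Im (f t)).

Definition cintegrable (a b : R) (f : R -> R[i]) : Prop :=
  mu.-integrable `[a, b] (fun t => (complex.Re (f t))%:E) /\
  mu.-integrable `[a, b] (fun t => (complex.Im (f t))%:E).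

Definition cL2 (a b : R) (f : R -> R[i]) : Prop :=
  [/\ measurable_fun `[a, b] (fun t => complex.Re (f t)),
      measurable_fun `[a, b] (fun t => complex.Im (f t)) &
      mu.-integrable `[a, b]
        (fun t => (complex.Re (f t) ^+ 2 + complex.Im (f t) ^+ 2)%:E)].

(* [F] is absolutely continuous on [[a, b]] and [f] is its almost everywhere
   derivative; when [f] is continuous this means that [F] is C^1 with
   derivative [f], one-sided at [a] and [b]. *)
Definition ac_deriv (a b : R) (F f : R -> R[i]) : Prop :=
  cintegrable a b f /\
  forall x, x \in `[a, b]%R -> F x = F a + cintegral a x f.

(* [f] is the C^1 representative of an element of H^2[a, b]; [f1] is its
   derivative on [[a, b]], and [f2] its weak second derivative. *)
Definition H2 (a b : R) (f f1 f2 : R -> R[i]) : Prop :=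
  [/\ ac_deriv a b f f1, ac_deriv a b f1 f2 & cL2 a b f2].

End Sobolev.

Section Laplacian.
Variables (R : realType) (G : metricGraph R).

(* Only the values of [f e] on [edge_set e] are meaningful. *)
Definition edge_fun := edge G -> R -> R[i].

Definition eq_L2 (f g : edge_fun) : Prop :=
  forall e, {ae @lebesgue_measure R,
    forall x, x \in `[endpt e false, endpt e true]%R -> f e x = g e x}.

Definition endval (f : edge_fun) (s : endpoint G) : R[i] :=
  f s.1 (endpt s.1 s.2).

(* The derivative into the edge, in terms of the derivative [f1]. *)
Definition ingoing (f1 : edge_fun) (s : endpoint G) : R[i] :=
  if s.2 then - endval f1 s else endval f1 s.

(* [laplacian D f g]: the function [f] is in the domain of L(G, D) and
   [L(G, D) f = g].  The elements of the domain are given by their C^1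
   representatives, while [g] matters only up to equality almost everywhere. *)
Definition laplacian (D : {set {set endpoint G}}) (f g : edge_fun) : Prop :=
  exists f1 f2 : edge_fun,
    [/\ forall e, H2 (endpt e false) (endpt e true) (f e) (f1 e) (f2 e),
        forall s t, vrel G s t -> endval f s = endval f t,
        forall v, v \in D -> forall s, s \in v -> endval f s = 0,
        forall v, v \in vertices G -> v \notin D ->
          \sum_(s in v) ingoing f1 s = 0 &
        eq_L2 g (fun e x => - f2 e x)].

Definition eigenfun (D : {set {set endpoint G}}) (lam : R[i]) (f : edge_fun) :=
  laplacian D f (fun e x => lam * f e x).

Definition is_eigenvalue (D : {set {set endpoint G}}) (lam : R[i]) : Prop :=
  exists f, eigenfun D lam f /\ ~ eq_L2 f (fun _ _ => 0).

Definition lin_indep (n : nat) (F : 'I_n -> edge_fun) : Prop :=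
  forall c : 'I_n -> R[i],
    eq_L2 (fun e x => \sum_i c i * F i e x) (fun _ _ => 0) ->
    forall i, c i = 0.

(* The dimension of the eigenspace, possibly [+oo]. *)
Definition multiplicity (D : {set {set endpoint G}}) (lam : R[i]) : \bar R :=
  ereal_sup [set n%:R%:E | n in
    [set n | exists F : 'I_n -> edge_fun,
       (forall i, eigenfun D lam (F i)) /\ lin_indep F]].

End Laplacian.

(* Main.v *)
Require Import Defs.
(** An eigenfunction is determined on an edge by its Cauchy data at one end. Let
    it vanish on a set of edges [Z], and let [v] be a vertex of degree [d] that
    meets [Z]: its value at [v] is zero, and at most [d - 1] edge ends at [v] lie
    outside [Z], with derivatives summing to zero. So [d - 2] linear conditions
    (none if [d = 1]) make it vanish on all the edges at [v]. Exploring the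
    connected graph from one edge in this way costs at most the sum over the
    non-pendant vertices of [d - 2], which is twice the Betti number minus [2]
    plus the number of pendant vertices. The starting edge costs one condition if
    it is pendant, and the bound follows. Without pendant vertices it costs two,
    and one condition has to be saved: unless the graph is a circle, some cycle
    contains a vertex [r] with [d >= 3]; going around that cycle from [r] before
    dealing with [r] reaches [r] through two of its edge ends, so that [r] costs
    at most [d - 3]. *)
From mathcomp Require Import all_boot all_order all_algebra.
From mathcomp Require Import zify.

Set Implicit Arguments.
Unset Strict Implicit.
Unset Printing Implicit Defensive.

Import Order.TTheory GRing.Theory Num.Theory.

(** * Linear conditions that force a solution to vanish *)

Local Open Scope ring_scope.

Definition opp_end (T : finType) (s : T * bool) : T * bool := (s.1, ~~ s.2).

Section Forcing.
Variables (K : fieldType) (T : finType) (vr : rel (T * bool)) (m : nat).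
(** The entries of [val s] and [der s] are the values and ingoing derivatives of [m] solutions at
    the edge end [s]; a row [c] stands for a linear combination of these solutions. *)
Variables (val der : T * bool -> 'cV[K]_m).
Hypothesis vr_equiv : equivalence_rel vr.
Implicit Types (Z Y : {set T}) (v r : {set T * bool}) (s t x : T * bool).
Implicit Types c : 'rV[K]_m.
Local Notation V := (equivalence_partition vr [set: T * bool]).

Hypothesis cauchy : forall (c : 'rV[K]_m) s, c *m val s = 0 -> c *m der s = 0 ->
  c *m val (opp_end s) = 0 /\ c *m der (opp_end s) = 0.
Hypothesis val_vr : forall s t, vr s t -> val s = val t.
Hypothesis kirchhoff : forall v, v \in V -> #|v| != 1%N ->
  \sum_(s in v) der s = 0.
Hypothesis pendant_cond : forall v s, v \in V -> #|v| = 1%N -> s \in v ->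
  val s = 0 \/ der s = 0.
Hypothesis cauchy0 : forall c : 'rV[K]_m,
  (forall s, c *m val s = 0 /\ c *m der s = 0) -> c = 0.
Hypothesis vr_connected : forall Z : {set T}, Z != set0 -> Z != setT ->
  exists s t, [/\ vr s t, s.1 \in Z & t.1 \notin Z].

Lemma vrr s : vr s s.
Proof. by have [] := vr_equiv s s s. Qed.

Lemma vr_sym s t : vr s t -> vr t s.
Proof. by move=> st; have [_ /(_ st) <-] := vr_equiv s t s; exact: vrr. Qed.

Lemma vr_trans s t u : vr s t -> vr t u -> vr s u.
Proof. by move=> st; have [_ /(_ st) <-] := vr_equiv s t u. Qed.

Lemma equiv_in : {in setT & &, equivalence_rel vr}.
Proof. by move=> s t u _ _ _; exact: vr_equiv. Qed.

Let vr_class s : {set T * bool} := [set t | vr s t].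

Lemma vr_classE s v : v \in V -> s \in v -> v = vr_class s.
Proof.
move=> /imsetP[x _ ->]; rewrite inE => /andP[_ xs]; apply/setP => y; rewrite !inE.
by apply/idP/idP; [apply: vr_trans; exact: vr_sym|exact: vr_trans].
Qed.

Lemma vr_class_in s : vr_class s \in V.
Proof. by apply/imsetP; exists s => //; apply/setP => t; rewrite !inE. Qed.

Lemma mem_vr_class s : s \in vr_class s.
Proof. by rewrite inE vrr. Qed.

(** * Zero sets and the functionals that force a solution to vanish *)

Definition vanishes (Z : {set T}) (c : 'rV[K]_m) :=
  forall s, s.1 \in Z -> c *m val s = 0 /\ c *m der s = 0.

Lemma vanishes_add Z c s : vanishes Z c ->
  c *m val s = 0 -> c *m der s = 0 -> vanishes (s.1 |: Z) c.
Proof.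
move=> Zc vs ds [e b] /=; rewrite !inE => /orP[/eqP ->|eZ]; last exact: Zc.
have [->|bs] := eqVneq b s.2; first by rewrite -surjective_pairing.
suff -> : (s.1, b) = opp_end s by exact: cauchy.
by rewrite /opp_end; congr pair; move: bs; case: b; case: s.2.
Qed.

(** The combinations vanishing on [Z] form a space of dimension at most [n]; explicit functionals
    are listed so that costs add up along an exploration. *)
Definition kills (Z : {set T}) (n : nat) := exists fs : seq 'cV[K]_m,
  (size fs <= n)%N /\
  forall c, vanishes Z c -> (forall g, g \in fs -> c *m g = 0) -> c = 0.

Lemma kills_le Z n n' : (n <= n')%N -> kills Z n -> kills Z n'.
Proof. by move=> nn [fs [sz h]]; exists fs; split => //; exact: leq_trans nn. Qed.

(** The functionals are the columns of a matrix with zero left kernel; its [m] rows are independent,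
    so there are at least [m] columns. *)
Lemma kills0_dim n : kills set0 n -> (m <= n)%N.
Proof.
case=> fs [sz h]; apply: leq_trans sz.
pose A := \matrix_(i < m, j < size fs) (fs`_j) i 0.
suff : row_free A by move=> /eqP rA; have := rank_leq_col A; rewrite rA.
rewrite -kermx_eq0; apply/eqP/row_matrixP => i; rewrite row0; apply: h.
  by move=> s; rewrite inE.
move=> g /(nthP 0)[j jlt <-].
have : row i (kermx A) *m A = 0 by rewrite -row_mul mulmx_ker row0.
move=> /matrixP/(_ 0 (Ordinal jlt)); rewrite [X in _ = X]mxE => E.
apply/matrixP => x y; rewrite !ord1 [RHS]mxE -E !mxE.
by apply: eq_bigr => k _; rewrite !mxE.
Qed.

Lemma kills_free Z n e :
  (forall c, vanishes Z c -> vanishes (e |: Z) c) ->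
  kills (e |: Z) n -> kills Z n.
Proof.
by move=> h [fs [sz hf]]; exists fs; split => // c Zc; apply: hf; exact: h.
Qed.

Lemma kills_cons Z n e (g : 'cV[K]_m) :
  (forall c : 'rV_m, vanishes Z c -> c *m g = 0 -> vanishes (e |: Z) c) ->
  kills (e |: Z) n -> kills Z n.+1.
Proof.
move=> h [fs [sz hf]]; exists (g :: fs); split => // c Zc cg.
apply: hf; last by move=> g' g'fs; apply: cg; rewrite inE g'fs orbT.
by apply: h => //; apply: cg; rewrite inE eqxx.
Qed.

(** * The cost of a vertex during an exploration *)

Definition alive (Z : {set T}) (v : {set T * bool}) :=
  #|[set s in v | s.1 \notin Z]|.

(* Bounds the number of functionals spent at [v] when the zero set grows from
   [Z]: a vertex reached through one edge needs [#|v| - 2] of them, and [r] is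
   a vertex known to be reached through two of its edges. *)
Definition weight (r : {set T * bool}) Z v :=
  minn (if (alive Z v < #|v|)%N then (alive Z v).-1 else #|v| - 2)%N
       (#|v| - (2 + (v == r)))%N.

Lemma alive_le Z v : (alive Z v <= #|v|)%N.
Proof. by apply: subset_leq_card; apply/subsetP => s; rewrite inE => /andP[]. Qed.

Lemma alive_mono (Z Z' : {set T}) v : Z \subset Z' -> (alive Z' v <= alive Z v)%N.
Proof.
move=> /subsetP ZZ'; apply: subset_leq_card; apply/subsetP => s.
by rewrite !inE => /andP[-> /=]; apply: contra => /ZZ'.
Qed.

Lemma alive_lt Z v s : s \in v -> s.1 \in Z -> (alive Z v < #|v|)%N.
Proof.
move=> sv sZ; apply: proper_card; apply/properP; split.
  by apply/subsetP => x; rewrite inE => /andP[].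
by exists s => //; rewrite inE sZ andbF.
Qed.

(** The delicate case is a vertex met by [Z'] but not by [Z]: at least one of its ends is no longer
    alive, so [(alive Z' v).-1] is at most [#|v| - 2]. *)
Lemma weight_mono r (Z Z' : {set T}) v :
  Z \subset Z' -> (weight r Z' v <= weight r Z v)%N.
Proof.
move=> ZZ'; have h1 := alive_mono v ZZ'; have h2 := alive_le Z v; rewrite /weight.
rewrite leq_min geq_minr andbT; apply: leq_trans (geq_minl _ _) _.
by case: ltnP => h3; case: ltnP => h4; lia.
Qed.

Lemma alive_add Z v s : s \in v -> s.1 \notin Z ->
  (alive (s.1 |: Z) v < alive Z v)%N.
Proof.
move=> sv sZ; apply: proper_card; apply/properP; split.
  by apply/subsetP => x; rewrite !inE negb_or => /andP[-> /andP[]].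
by exists s; rewrite !inE ?sv ?sZ // eqxx.
Qed.

(** The value at the vertex of [s] is zero because [t] lies on [Z]. If [s] is the only end alive
    there, the Kirchhoff condition gives a zero derivative for free; otherwise [der s] is one more
    functional, paid for by the drop in the weight of this vertex. *)
Lemma kills_step r Z s t : vr s t -> s.1 \notin Z -> t.1 \in Z ->
  vr_class s != r ->
  kills (s.1 |: Z) (\sum_(v in V) weight r (s.1 |: Z) v)%N ->
  kills Z (\sum_(v in V) weight r Z v)%N.
Proof.
move=> st sZ tZ sr.
have vV := vr_class_in s; set v := vr_class s in sr vV *.
have sv : s \in v by exact: mem_vr_class.
have tv : t \in v by rewrite inE.
have sNt : s != t by apply: contraNneq sZ => ->.
have v0 c : vanishes Z c -> c *m val s = 0.
  by move=> Zc; rewrite (val_vr st); case: (Zc t).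
(* Two distinct ends meet at [v], so the Kirchhoff condition is available there. *)
have v1 : #|v| != 1%N.
  apply/negP => /cards1P[x vx]; move: sv tv sNt; rewrite vx !inE => /eqP -> /eqP ->.
  by rewrite eqxx.
have alv := alive_add sv sZ; have alv' := alive_lt tv tZ.
rewrite (bigD1 v) //= [X in _ -> kills _ X](bigD1 v) //=.
set a := (\sum_(i in V | i != v) _)%N; set b := (\sum_(i in V | i != v) _)%N.
have ab : (a <= b)%N by apply: leq_sum => u _; apply: weight_mono; exact: subsetUr.
have alv'' : (alive (s.1 |: Z) v < #|v|)%N by exact: ltn_trans alv'.
have w1 : weight r (s.1 |: Z) v = (alive (s.1 |: Z) v).-1.
  rewrite /weight alv'' (negbTE sr) addn0.
  by move: alv''; move: (alive _ v) (#|v|) => k d; lia.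
have w2 : weight r Z v = (alive Z v).-1.
  rewrite /weight alv' (negbTE sr) addn0.
  by move: alv'; move: (alive _ v) (#|v|) => k d; lia.
have [k1|k1] := leqP (alive Z v) 1.
  move=> h; apply: (kills_free (e := s.1)); last first.
    apply: kills_le h; apply: leq_add => //; rewrite w1 w2.
    by move: alv; move: (alive _ v) (alive Z v) => k k'; lia.
  move=> c Zc; apply: (vanishes_add Zc (v0 c Zc)).
  have := congr1 (mulmx c) (kirchhoff vV v1); rewrite mulmx0 mulmx_sumr.
  rewrite (bigD1 s) //= big1 ?addr0 // => x /andP[xv xs].
  suff /Zc[] : x.1 \in Z by [].
  apply: contraLR k1 => xZ; rewrite -ltnNge.
  have -> : 2%N = #|[set s; x]| by rewrite cards2 eq_sym xs.
  apply: subset_leq_card; apply/subsetP => y; rewrite !inE => /orP[] /eqP ->.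
    by rewrite vrr.
  by rewrite xZ andbT; move: xv; rewrite inE.
move=> h.
apply: (@kills_le _ (weight r (s.1 |: Z) v + a).+1).
  rewrite w1 w2; move: alv k1 ab.
  by move: (alive _ v) (alive Z v) => k k'; lia.
apply: (kills_cons (g := der s)) h => c Zc cs.
exact: vanishes_add Zc (v0 c Zc) cs.
Qed.

(** Connectedness always supplies a next edge for [kills_step]. Taking [set0], which is no vertex,
    for [r] charges every vertex at the ordinary rate. *)
Lemma kills_nonempty Z : Z != set0 -> kills Z (\sum_(v in V) weight set0 Z v)%N.
Proof.
move: {2}#|~: Z| (leqnn #|~: Z|) => n; elim: n Z => [|n IHn] Z Zn Z0.
  exists [::]; split => // c Zc _; apply: cauchy0 => s; apply: Zc.
  move: Zn; rewrite leqn0 cards_eq0 => /eqP/setP/(_ s.1).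
  by rewrite !inE => /negbFE.
have [ZT|ZT] := eqVneq Z setT.
  by apply: IHn => //; rewrite ZT setCT cards0.
have [t [s [ts tZ sZ]]] := vr_connected Z0 ZT.
apply: (@kills_step _ _ s t) => //; first exact: vr_sym.
  by apply/negP => /eqP/setP/(_ s); rewrite mem_vr_class inE.
apply: IHn; last by apply/set0Pn; exists s.1; rewrite !inE eqxx.
rewrite -ltnS; apply: leq_trans Zn; apply: proper_card; apply/properP; split.
  by rewrite setCS subsetUr.
by exists s.1; rewrite !inE ?eqxx.
Qed.

(* A minimal [leafless] set is the edge set of a cycle. One exceptional vertex is
   tolerated so that an exploration that starts at that vertex and gets stuck
   has visited a [leafless] set, hence the whole cycle. *)
Definition leafless (Z : {set T}) := (Z != set0) &&
  [exists x : T * bool, forall s : T * bool, (s.1 \in Z) && ~~ vr x s ==>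
     [exists t, [&& t != s, vr s t & t.1 \in Z]]].

Lemma leaflessP Z : reflect (Z != set0 /\ exists x, forall s, s.1 \in Z ->
    ~~ vr x s -> exists t, [/\ t != s, vr s t & t.1 \in Z]) (leafless Z).
Proof.
apply: (iffP andP) => -[Z0 h]; split => //.
  have {h} /existsP[x /forallP h] := h; exists x => s sZ xs.
  by have /implyP/(_ _)/existsP[|t /and3P[]] := h s; [rewrite sZ|exists t].
have [x {}h] := h; apply/existsP; exists x; apply/forallP => s.
apply/implyP => /andP[sZ xs]; have [t [? ? ?]] := h _ sZ xs.
by apply/existsP; exists t; apply/and3P.
Qed.

(** A minimal set has no exceptional vertex: if [s] were a lone end, it would lie at that vertex,
    and deleting its edge would leave a smaller leafless set, with the vertex at the other end of
    the edge as the new exception. *)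
Lemma minset_leafless Z : minset leafless Z ->
  forall s, s.1 \in Z -> exists t, [/\ t != s, vr s t & t.1 \in Z].
Proof.
move=> /minsetP[/leaflessP[Z0 [x hx]] Zmin] s sZ.
have [/existsP[t /and3P[]]|/existsPn nt] :=
  boolP [exists t, [&& t != s, vr s t & t.1 \in Z]]; first by exists t.
have xs : vr x s.
  apply: contraT => xs; have [t [? ? ?]] := hx _ sZ xs.
  by case/negP: (nt t); apply/and3P.
(* A loop would provide its own second end as a partner of [s]. *)
have sso : ~~ vr s (opp_end s).
  apply: contra (nt (opp_end s)) => ->; rewrite sZ /= andbT.
  by rewrite /opp_end; case: (s) => e []; rewrite xpair_eqE andbF.
have xso : ~~ vr x (opp_end s).
  by apply: contra sso => xso; apply: vr_trans xso; exact: vr_sym.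
have notin u : u.1 != s.1 -> u.1 \in Z -> u.1 \in Z :\ s.1 by rewrite !inE => ->.
have other u : u != s -> u != opp_end s -> u.1 != s.1.
  rewrite /opp_end; case: u => e b; case: (s) => e' b' /= h1 h2.
  apply/eqP => ee; move: h1 h2; rewrite ee !xpair_eqE eqxx /=.
  by case: b; case: b'.
have : leafless (Z :\ s.1).
  apply/leaflessP; split.
    have [t [tso sot tZ]] := hx (opp_end s) sZ xso.
    apply/set0Pn; exists t.1; apply: (notin) => //; apply: other => //.
    by apply: contraNneq sso => ts; apply: vr_sym; rewrite -{2}ts.
  exists (opp_end s) => s'; rewrite !inE => /andP[s's s'Z] sos'.
  have [xs'|xs'] := boolP (vr x s').
    have := nt s'; rewrite s'Z (vr_trans (vr_sym xs) xs') !andbT negbK => /eqP ss'.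
    by rewrite ss' eqxx in s's.
  have [t [ts' s't tZ]] := hx _ s'Z xs'.
  exists t; split => //; apply: (notin) => //; apply: other.
    by apply: contraNneq xs' => ts; apply: vr_trans xs _; rewrite -ts; exact: vr_sym.
  by apply: contraNneq sos' => <-; exact: vr_sym.
move=> /Zmin -/(_ (subD1set _ _))/setP/(_ s.1).
by rewrite !inE eqxx sZ.
Qed.

(** The exploration stays in the cycle [Z] and takes no step at [x] until all of [Z] is reached. By
    then [x] has two ends on [Z], so its ordinary cost is already within the reduced weight. *)
Lemma kills_in_leafless Z x (Y : {set T}) : minset leafless Z -> Y \subset Z ->
  (exists2 s, vr x s & s.1 \in Y) ->
  kills Y (\sum_(v in V) weight (vr_class x) Y v)%N.
Proof.
move=> Zmin; move: {2}#|Z :\: Y| (leqnn #|Z :\: Y|) => n.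
have nl := minset_leafless Zmin; have /minsetP[Zl Zm] := Zmin.
elim: n Y => [|n IHn] Y Yn YZ [x' xx' xY].
  have YZ' : Y = Z.
    apply/eqP; rewrite eqEsubset YZ; apply/subsetP => e eZ.
    move: Yn; rewrite leqn0 cards_eq0 => /eqP/setP/(_ e).
    by rewrite !inE eZ andbT => /negbFE.
  have := kills_nonempty; move=> /(_ Z) h.
  rewrite YZ'; apply: kills_le (h _); last by have /leaflessP[] := Zl.
  apply: leq_sum => v vV; rewrite /weight.
  have [vx|vx] := eqVneq v (vr_class x); last first.
    rewrite leq_min geq_minl /=; apply: leq_trans (geq_minr _ _) _.
    exact: leq_sub2l (leq_addr _ _).
  suff : (alive Z v <= #|v| - 2)%N.
    move=> h1; rewrite leq_min geq_minl /=; apply: leq_trans (geq_minl _ _) _.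
    by case: ltnP => h2; move: h1 h2; move: (alive Z v) (#|v|) => k n0; lia.
  have x'v : x' \in v by rewrite vx inE.
  (* A second end on [Z] at the vertex of [x], next to [x']: at most [#|v| - 2] ends remain
     alive. *)
  rewrite YZ' in xY; have [y [yx xy yZ]] := nl _ xY.
  have yv : y \in v by rewrite vx inE; exact: vr_trans xy.
  rewrite /alive; have -> : (#|v| - 2)%N = #|v :\: [set x'; y]|.
    rewrite cardsD (setIidPr _) ?cards2 1?eq_sym ?yx //.
    by apply/subsetP => z; rewrite !inE => /orP[] /eqP ->.
  apply: subset_leq_card; apply/subsetP => z; rewrite !inE => /andP[-> zZ].
  rewrite andbT; apply/negP => /orP[] /eqP zE; first by rewrite zE xY in zZ.
  by rewrite zE yZ in zZ.
have [/existsP[t /existsP[s /and5P[ts tY sZ sY tx]]]|/existsPn stuck] :=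
  boolP [exists t, [exists s,
    [&& vr t s, t.1 \in Y, s.1 \in Z, s.1 \notin Y & ~~ vr x t]]].
  apply: (@kills_step _ _ s t) => //; first exact: vr_sym.
    apply: contraNneq tx => /setP/(_ t).
    by rewrite !inE (vr_sym ts) => <-.
  apply: IHn; last by exists x' => //; rewrite !inE xY orbT.
    rewrite -ltnS; apply: leq_trans Yn; apply: proper_card.
    apply/properP; split.
      by apply: setDS; exact: subsetUr.
    by exists s.1; rewrite !inE ?sZ ?sY ?eqxx.
  by apply/subsetP => e; rewrite !inE => /orP[/eqP ->//|/(subsetP YZ)].
(* When no step is possible away from [x], partners in [Z] of ends on [Y] are themselves on [Y]. So
   [Y] is leafless with exceptional vertex [x], and equals [Z] by minimality. *)
have Yl : leafless Y.
  apply/leaflessP; split; first by apply/set0Pn; exists x'.1.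
  exists x => s sY xs; have [t [ts st tZ]] := nl _ (subsetP YZ _ sY).
  exists t; split => //; have /existsPn/(_ t) := stuck s.
  by rewrite st sY tZ xs /= andbT negbK.
apply: IHn => //; last by exists x'.
by rewrite (Zm _ Yl YZ) setDv cards0.
Qed.

(** * The degree count and the resulting bound *)

Lemma sum_card_V : (\sum_(v in V) #|v| = 2 * #|T|)%N.
Proof.
have /card_partition <- : partition V setT.
  by apply: equivalence_partitionP; exact: equiv_in.
by rewrite cardsT card_prod card_bool mulnC.
Qed.

Lemma forcing_bound (e0 : T) :
  (exists2 v, v \in V & #|v| != 2%N) ->
  (m%:Z <= #|[set v in V | #|v| == 1%N]|%:Z + 2 * (#|T|%:Z - #|V|%:Z + 1) - 1).
Proof.
move=> [v0 v0V v02].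
set P := #|_|.
have card_gt0 v : v \in V -> (0 < #|v|)%N.
  by move=> /imsetP[x _ ->]; apply/card_gt0P; exists x; rewrite !inE vrr.
(* Degrees are positive, so the truncated [#|v| - 2] exceeds the true difference only at pendant
   vertices, and there by one. *)
have sumP : (\sum_(v in V) (#|v| - 2) + 2 * #|V| = 2 * #|T| + P)%N.
  rewrite -sum_card_V /P -sum1dep_card -[#|V|]sum1_card big_distrr /=.
  rewrite [X in (_ + X)%N = _](eq_bigr (fun=> 2%N)); last by move=> v; rewrite muln1.
  rewrite -big_split /= [X in _ = (_ + X)%N]big_mkcondr /= -big_split /=.
  by apply: eq_bigr => v /card_gt0; move: (#|v|) => n; case: eqP; lia.
(* With a pendant vertex, the exploration starts on its edge, where one Cauchy datum is zero and
   only the other is paid for. *)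
have [P0|] := posnP P; last first.
  move=> /card_gt0P[v]; rewrite inE => /andP[vV /eqP v1].
  have /cards1P[s vs] : #|v| == 1%N by rewrite v1.
  have sv : s \in v by rewrite vs inE.
  suff /kills0_dim : kills set0 (1 + \sum_(v in V) (#|v| - 2))%N by lia.
  have h : kills (s.1 |: set0) (\sum_(v in V) (#|v| - 2))%N.
    apply: kills_le (kills_nonempty _).
      by apply: leq_sum => u uV; rewrite /weight;
        apply: leq_trans (geq_minr _ _) (leq_sub2l _ (leq_addr _ _)).
    by apply/set0Pn; exists s.1; rewrite !inE eqxx.
  have [g0|g0] := pendant_cond vV v1 sv.
    apply: (kills_cons (g := der s)) h => c c0 cd; apply: vanishes_add => //.
    by rewrite g0 mulmx0.
  apply: (kills_cons (g := val s)) h => c c0 cd; apply: vanishes_add => //.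
  by rewrite g0 mulmx0.
have deg2 v : v \in V -> (2 <= #|v|)%N.
  move=> vV; rewrite ltn_neqAle eq_sym card_gt0 // andbT; apply/negP => v1.
  by move/eqP: P0; rewrite cards_eq0 => /eqP/setP/(_ v); rewrite !inE vV v1.
have lT : leafless setT.
  apply/leaflessP; split; first by apply/set0Pn; exists e0.
  exists (e0, true) => s _ _.
  have := deg2 _ (vr_class_in s); rewrite (cardsD1 s) mem_vr_class.
  by move=> /card_gt0P[t]; rewrite !inE => /andP[? ?]; exists t.
have [Z Zmin _] := minset_exists lT.
have /minsetP[/leaflessP[/set0Pn[z zZ] _] _] := Zmin.
(* The cycle [Z] has a vertex of degree at least three. Otherwise either [Z] is the whole graph and
   all degrees are two, against [v02], or an edge outside [Z] is attached at a vertex with two ends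
   on [Z], which makes three. *)
have [/existsP[r /andP[rZ r3]]|/existsPn nr] :=
    boolP [exists r, (r.1 \in Z) && (2 < #|vr_class r|)%N]; last first.
  have [ZT|ZT] := eqVneq Z setT.
    case/negP: v02; have /card_gt0P[s sv] := card_gt0 _ v0V.
    have := nr s; rewrite ZT inE /= -leqNgt (vr_classE v0V sv) => s2.
    by rewrite eqn_leq s2 deg2 // vr_class_in.
  have Z0 : Z != set0 by apply/set0Pn; exists z.
  have [s [t [st sZ tZ]]] := vr_connected Z0 ZT.
  have [u [us su uZ]] := minset_leafless Zmin sZ.
  have tu : t != u by apply: contraNneq tZ => ->.
  have ts : t != s by apply: contraNneq tZ => ->.
  have := nr s; rewrite sZ /= => /negP []; rewrite (cardsD1 s) mem_vr_class.
  by rewrite (cardsD1 u) !inE us su (cardsD1 t) !inE tu ts st.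
have rV := vr_class_in r.
(* Both Cauchy data at [r] are paid for; the reduced weight of its vertex gives one back, since a
   degree of at least three makes [#|v| - 3] strictly smaller than [#|v| - 2]. *)
suff /kills0_dim : kills set0 (2 + \sum_(v in V) weight (vr_class r) [set r.1] v)%N.
  have : (\sum_(v in V) weight (vr_class r) [set r.1] v + 1 <=
          \sum_(v in V) (#|v| - 2))%N.
    rewrite (bigD1 (vr_class r)) //= [X in (_ <= X)%N](bigD1 (vr_class r)) //=.
    rewrite addnAC; apply: leq_add; last first.
      by apply: leq_sum => v _;
        apply: leq_trans (geq_minr _ _) (leq_sub2l _ (leq_addr _ _)).
    rewrite /weight eqxx addn1; apply: leq_ltn_trans (geq_minr _ _) _.
    by move: r3; move: (#|_|) => k; lia.
  by lia.
have h : kills (r.1 |: set0) (\sum_(v in V) weight (vr_class r) [set r.1] v)%N.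
  rewrite setU0; apply: kills_in_leafless Zmin _ _; first by rewrite sub1set.
  by exists r; rewrite ?vrr // inE.
rewrite -[set0]setU0.
have {h} [fs [sz hf]] := h; exists [:: val r, der r & fs]; split; first by [].
move=> c _ cf; apply: hf => [|g gfs]; last by apply: cf; rewrite !inE gfs !orbT.
apply: vanishes_add; first by move=> s; rewrite inE.
  by apply: cf; rewrite !inE eqxx.
by apply: cf; rewrite !inE eqxx orbT.
Qed.
End Forcing.

(** * Connected graphs all of whose vertices have degree two *)

Local Close Scope ring_scope.

Section CycleGraph.
Variables (T : finType) (vr : rel (T * bool)).
Hypothesis vr_equiv : equivalence_rel vr.
Local Notation V := (equivalence_partition vr [set: T * bool]).
Hypothesis card2 : forall v, v \in V -> #|v| = 2.
Hypothesis vr_connected : forall Z : {set T}, Z != set0 -> Z != setT ->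
  exists s t, [/\ vr s t, s.1 \in Z & t.1 \notin Z].
Implicit Types s t : T * bool.

(** The other end at the vertex of [s]; the default is never taken, as every vertex has two ends. *)
Definition mate s := odflt s [pick t | (t != s) && vr s t].

Lemma mateP s : [/\ mate s != s, vr s (mate s) &
  forall t, vr s t -> t = s \/ t = mate s].
Proof.
have := card2 (vr_class_in vr s); rewrite (cardsD1 s) (mem_vr_class vr_equiv).
case=> /eqP/cards1P[t st].
have /setP/(_ t) := st; rewrite !inE eqxx => /andP[ts vst].
have mt : mate s = t.
  rewrite /mate; case: pickP => [u /andP[us su]|/(_ t)]; last by rewrite ts vst.
  by move/setP/(_ u): st; rewrite !inE us su /= => /esym/eqP.
rewrite mt; split => // u su; have [->|us] := eqVneq u s; [by left|right].
by move/setP/(_ u): st; rewrite !inE us su /= => /esym/eqP.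
Qed.

Lemma mateK : involutive mate.
Proof.
move=> s; have [ms vs _] := mateP s; have [_ _ h] := mateP (mate s).
have [h1|h1] := h s (vr_sym vr_equiv vs); last by [].
by rewrite {2}h1 eqxx in ms.
Qed.

Lemma opp_endK : involutive (@opp_end T).
Proof. by case=> e b; rewrite /opp_end negbK. Qed.

Lemma opp_end_neq s : opp_end s != s.
Proof. by case: s => e []; rewrite /opp_end xpair_eqE andbF. Qed.

(** One step around the cycle: an end stands for its edge traversed from there, and [turn] passes to
    the start of the next edge. *)
Definition turn s := mate (opp_end s).

Lemma turn_inj : injective turn.
Proof. exact: inj_comp (inv_inj mateK) (inv_inj opp_endK). Qed.

(* [turn] is the product of the fixed-point free involutions [mate] and
   [opp_end]; equality would yield a fixed point of one of them. *)
Lemma iter_turn_neq k s : iter k turn s != opp_end s.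
Proof.
have [n] := ubnP k; elim: n k s => // n IHn [|[|k]] s kn.
- by rewrite eq_sym opp_end_neq.
- by have [] := mateP (opp_end s).
apply/eqP => h; have /negP[] : iter k turn (turn s) != opp_end (turn s).
  by apply: IHn; rewrite ltnS in kn; exact: ltnW.
apply/eqP; rewrite -iterSr; apply: (inv_inj opp_endK).
apply: (inv_inj mateK); rewrite opp_endK.
by rewrite -[LHS]/(iter k.+2 turn s) h /turn mateK.
Qed.

(** No vertex leads out of the set of edges met by the orbit: the mate of an orbit point is the far
    end of its predecessor, and the mate of the far end of an orbit point is its successor.
    Connectedness concludes. *)
Lemma turn_cover s0 e : exists b, fconnect turn s0 (e, b).
Proof.
pose Z := [set e | [exists b, fconnect turn s0 (e, b)]].
suff : Z = setT by move/setP/(_ e); rewrite !inE => /existsP.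
have ZP s : s.1 \in Z -> fconnect turn s0 s \/ fconnect turn s0 (opp_end s).
  rewrite inE => /existsP[b]; case: s => e' b' /=.
  by case: b; case: b'; rewrite /opp_end; auto.
have inZ s : fconnect turn s0 s -> s.1 \in Z.
  by move=> h; rewrite inE; apply/existsP; exists s.2; rewrite -surjective_pairing.
apply/eqP; apply: contraT => ZT.
have Z0 : Z != set0 by apply/set0Pn; exists s0.1; apply: inZ; exact: connect0.
have [s [t [st sZ tZ]]] := vr_connected Z0 ZT.
have [_ _ /(_ t st) [ts|ts]] := mateP s; first by rewrite ts sZ in tZ.
have [h|h] := ZP _ sZ.
  suff : t.1 \in Z by rewrite (negbTE tZ).
  have -> : t = opp_end (finv turn s).
    rewrite ts -{1}(f_finv turn_inj s) /turn mateK //.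
  rewrite /=; apply: inZ; apply: connect_trans h _.
  exact: fconnect_finv.
case/negP: tZ; apply: inZ; apply: connect_trans h _.
by apply: connect1; rewrite /= /turn opp_endK ts.
Qed.

(* [e] is the [idx e]-th edge of the cycle and is traversed from [(e, side e)]
   to [(e, ~~ side e)]. *)
Lemma cycle_enum (e0 : T) : exists (n : nat) (idx : T -> nat) (side : T -> bool),
  [/\ injective idx,
      forall e, idx e < n,
      forall k, k < n -> exists e, idx e = k,
      forall e f, idx f = (idx e).+1 %% n -> vr (e, ~~ side e) (f, side f) &
      forall s t, vr s t -> s = t \/ exists e f, idx f = (idx e).+1 %% n /\
        (s = (e, ~~ side e) /\ t = (f, side f) \/
         t = (e, ~~ side e) /\ s = (f, side f))].
Proof.
pose s0 := (e0, false); pose n := fingraph.order turn s0.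
pose side e := ~~ fconnect turn s0 (e, false).
pose start e := (e, side e); pose idx e := findex turn s0 (start e).
have startP e : fconnect turn s0 (start e).
  rewrite /start /side; case hF: (fconnect turn s0 (e, false)) => //=.
  by have [[] h] := turn_cover s0 e; [|rewrite h in hF].
(* The orbit contains at least one end of each edge by [turn_cover] and at most one by
   [iter_turn_neq]; thus it fixes a direction for every edge. *)
have not_both s : fconnect turn s0 s -> ~~ fconnect turn s0 (opp_end s).
  move=> h; apply/negP => h'; have : fconnect turn s (opp_end s).
    by apply: connect_trans h'; rewrite fconnect_sym //; exact: turn_inj.
  by move=> /iter_findex /eqP; rewrite (negbTE (iter_turn_neq _ _)).
have startE s : fconnect turn s0 s -> start s.1 = s.
  move=> h; have := not_both _ h; have := startP s.1; rewrite /start.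
  case: s h => e b /= h; rewrite /opp_end /=; have [<- //|] := eqVneq (side e) b.
  by move=> sb; have -> : ~~ b = side e by [case: (b) (side e) sb => [] []]; move=> ->.
have finishE s : ~~ fconnect turn s0 s -> s = (s.1, ~~ side s.1).
  case: s => e b /= nb; congr pair; have := startP e; rewrite /start.
  by case: b nb; case: (side e) => // nb; rewrite (negbTE nb).
have iter_idx e : iter (idx e) turn s0 = start e by exact: iter_findex.
have idx_lt e : idx e < n by exact: findex_max.
have n_gt0 : 0 < n by exact: fingraph.order_gt0.
have iter_mod k : iter (k %% n) turn s0 = iter k turn s0.
  rewrite [in RHS](divn_eq k n) addnC iterD; congr iter.
  elim: (k %/ n) => [|q IHq]; first by rewrite mul0n.
  by rewrite mulSn iterD -IHq iter_order //; exact: turn_inj.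
have idx_succ e f : idx f = (idx e).+1 %% n -> start f = turn (start e).
  by move=> h; rewrite -!iter_idx h iter_mod.
have succ_idx e f : start f = turn (start e) -> idx f = (idx e).+1 %% n.
  move: (iter_idx e) => <- h; rewrite {1}/idx h -iterS -iter_mod.
  by apply: findex_iter; exact: ltn_pmod.
exists n, idx, side; split => //.
- by move=> e f ef; have := iter_idx e; rewrite ef iter_idx => -[].
- move=> k kn; exists (iter k turn s0).1.
  by rewrite /idx startE ?findex_iter // fconnect_iter.
- move=> e f /idx_succ; rewrite -/(start f) => ->.
  by have [] := mateP (e, ~~ side e).
move=> s t st; have [<-|sNt] := eqVneq s t; [by left|right].
have tE : t = mate s.
  by have [_ _ /(_ t st) [ts|]] := mateP s; first by rewrite ts eqxx in sNt.
have sE : s = mate t by rewrite tE mateK.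
(* Of two mates exactly one is in the orbit: it starts its edge, and the other finishes the
   preceding one. *)
have [sS|sS] := boolP (fconnect turn s0 s); last first.
  exists s.1, t.1; have ss := finishE _ sS.
  have ts : t = turn (start s.1) by rewrite tE {1}ss.
  have tt : start t.1 = t.
    by apply: startE; rewrite ts; apply: connect_trans (startP _) (fconnect1 _ _).
  split; first by apply: succ_idx; rewrite tt.
  by left; split => //; rewrite -{1}tt.
have [tS|tS] := boolP (fconnect turn s0 t).
  have := not_both _ tS; have -> : opp_end t = finv turn s.
    by rewrite tE -{1}(f_finv turn_inj s) /turn mateK opp_endK.
  by rewrite (connect_trans sS (fconnect_finv _ _)).
exists t.1, s.1; have tt := finishE _ tS.
have ss : start s.1 = s by exact: startE.
split; first by apply: succ_idx; rewrite ss sE {1}tt.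
by right; split => //; rewrite -{1}ss.
Qed.
End CycleGraph.

(** * Cauchy uniqueness on an edge *)

From mathcomp Require Import generic_quotient complex lra.
From mathcomp Require Import all_classical all_reals all_analysis.

Import numFieldNormedType.Exports.

Local Open Scope classical_set_scope.
Local Open Scope ring_scope.
Local Open Scope complex_scope.
Local Open Scope quotient_scope.

Section Gronwall.
Variable R : realType.
Implicit Types (a b C x : R) (E dE g F : R -> R).
Local Notation mu := (@lebesgue_measure R).

(** [E] times [expR (- C * x)] is nonincreasing and [E] times [expR (C * x)] is nondecreasing. The
    first handles a zero at [a], the second a zero at [b]. *)
Lemma gronwall0 a b C E dE : {within `[a, b], continuous E} ->
  (forall x, x \in `]a, b[ -> is_derive x 1 E (dE x)) ->
  (forall x, x \in `]a, b[ -> `|dE x| <= C * E x) ->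
  (forall x, x \in `[a, b] -> 0 <= E x) ->
  E a = 0 \/ E b = 0 -> forall x, x \in `[a, b] -> E x = 0.
Proof.
move=> cE dE1 dEC E0 Eab x xab.
have dexp (k t : R) : is_derive t 1 (fun y => expR (k * y)) (k * expR (k * t)).
  by apply: is_derive_eq; rewrite /GRing.scale /=; lra.
have cexp (k : R) : {within `[a, b], continuous (fun y : R => expR (k * y))}.
  apply: continuous_subspaceT => t; apply: differentiable_continuous.
  exact/derivable1_diffP.
have dG (k t : R) : t \in `]a, b[ -> is_derive t 1 (fun y => E y * expR (k * y))
    (expR (k * t) * (dE t + k * E t)).
  move=> tab; have dEt := dE1 _ tab; have dk := dexp k t.
  apply: (is_derive_eq (is_deriveM dEt dk)).
  by rewrite /GRing.scale /=; lra.
have cG (k : R) : {within `[a, b], continuous (fun y => E y * expR (k * y))}.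
  by move=> t; apply: cvgM; [exact: cE|exact: cexp].
have aab : a \in `[a, b].
  by move: xab; rewrite !in_itv /= lexx => /andP[]; apply: le_trans.
have bab : b \in `[a, b].
  by move: xab; rewrite !in_itv /= lexx andbT => /andP[]; apply: le_trans.
have [ax xb] : a <= x /\ x <= b by move: xab; rewrite in_itv => /andP.
apply/eqP; rewrite eq_le E0 // andbT.
have dEC' t : t \in `]a, b[ -> dE t + - C * E t <= 0 /\ 0 <= dE t + C * E t.
  by move=> /dEC; rewrite ler_norml => /andP[? ?]; split; lra.
case: Eab => Eab.
  have := @ler0_derive1_le_cc _ (fun y => E y * expR (- C * y)) a b _ _ (cG (- C)).
  move=> /(_ _ _ x a xab aab ax); rewrite Eab mul0r pmulr_lle0 ?expR_gt0 //; apply.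
  - by move=> t tab; have [] := dG (- C) _ tab.
  - move=> t tab; rewrite derive1E; have [_ ->] := dG (- C) _ tab.
    by rewrite pmulr_rle0 ?expR_gt0 //; case: (dEC' _ tab).
have := @ger0_derive1_le_cc _ (fun y => E y * expR (C * y)) a b _ _ (cG C).
move=> /(_ _ _ x b xab bab xb); rewrite Eab mul0r pmulr_lle0 ?expR_gt0 //; apply.
- by move=> t tab; have [] := dG C _ tab.
- move=> t tab; rewrite derive1E; have [_ ->] := dG C _ tab.
  by rewrite pmulr_rge0 ?expR_gt0 //; case: (dEC' _ tab).
Qed.

Lemma primitive_continuous a b F g : a < b ->
  mu.-integrable `[a, b] (EFin \o g) ->
  (forall x, x \in `[a, b] -> F x = F a + \int[mu]_(t in `[a, x]) g t) ->
  {within `[a, b], continuous F}.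
Proof.
move=> ab ig Fg.
have cI := parameterized_integral_continuous (ltW ab) ig.
have cG : {within `[a, b], continuous (fun x => F a + parameterized_integral mu a x g)}.
  by move=> x; apply: cvgD; [exact: cvg_cst|exact: cI].
apply: subspace_eq_continuous cG => x /set_mem xab.
by rewrite [RHS]Fg.
Qed.

Lemma primitive_derive a b F g : a < b ->
  {within `[a, b], continuous g} ->
  (forall x, x \in `[a, b] -> F x = F a + \int[mu]_(t in `[a, x]) g t) ->
  forall x, x \in `]a, b[ -> is_derive x 1 F (g x).
Proof.
move=> ab cg Fg x xab.
have ig : mu.-integrable `[a, b] (EFin \o g).
  by apply: continuous_compact_integrable => //; exact: segment_compact.
have [ax xb] : a < x /\ x < b by move: xab; rewrite in_itv => /andP.
have [dF F'] := continuous_FTC1_closed xb ig ax (within_continuous_continuous ab cg xab).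
have dF' : is_derive x 1 (fun x => \int[mu]_(t in `[a, x]) g t) (g x).
  by split; [exact: dF|rewrite -derive1E; exact: F'].
have dF2 : is_derive x 1 (fun x => F a + \int[mu]_(t in `[a, x]) g t) (g x).
  by apply: (is_derive_eq (is_deriveD (is_derive_cst (F a) x 1) dF')); rewrite add0r.
apply: near_eq_is_derive dF2.
apply: filterS (near_in_itvoo xab) => y /subset_itv_oo_cc yab.
by rewrite -Fg.
Qed.
End Gronwall.

(** * Complex-valued solutions of the eigenvalue equation *)

Section ComplexDerivative.
Variable R : realType.
Implicit Types (a b x : R) (f g : R -> R[i]) (c lam : R[i]).
Local Notation mu := (@lebesgue_measure R).

Definition cderiv a b f g :=
  [/\ {within `[a, b], continuous (fun x => complex.Re (f x))},
      {within `[a, b], continuous (fun x => complex.Im (f x))},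
      forall x, x \in `]a, b[ ->
        is_derive x 1 (fun x => complex.Re (f x)) (complex.Re (g x)) &
      forall x, x \in `]a, b[ ->
        is_derive x 1 (fun x => complex.Im (f x)) (complex.Im (g x))].

Lemma ReD (y z : R[i]) : complex.Re (y + z) = complex.Re y + complex.Re z.
Proof. by case: y => ? ?; case: z. Qed.
Lemma ImD (y z : R[i]) : complex.Im (y + z) = complex.Im y + complex.Im z.
Proof. by case: y => ? ?; case: z. Qed.
Lemma ReM (y z : R[i]) : complex.Re (y * z) =
  complex.Re y * complex.Re z - complex.Im y * complex.Im z.
Proof. by case: y => ? ?; case: z. Qed.
Lemma ImM (y z : R[i]) : complex.Im (y * z) =
  complex.Re y * complex.Im z + complex.Im y * complex.Re z.
Proof. by case: y => ? ?; case: z. Qed.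

Lemma complex0P (z : R[i]) : complex.Re z ^+ 2 + complex.Im z ^+ 2 = 0 -> z = 0.
Proof.
case: z => u v /= /eqP; rewrite paddr_eq0 ?sqr_ge0 // !sqrf_eq0.
by move=> /andP[/eqP -> /eqP ->].
Qed.

Lemma within_continuous_lin a b (k l : R) (u v w : R -> R) :
  {within `[a, b], continuous u} -> {within `[a, b], continuous v} ->
  {within `[a, b], continuous w} ->
  {within `[a, b], continuous (fun x => k * u x + l * v x + w x)}.
Proof.
move=> cu cv cw x; apply: cvgD; last exact: cw.
by apply: cvgD; apply: cvgM; [exact: cvg_cst|exact: cu|exact: cvg_cst|exact: cv].
Qed.

Lemma is_derive_lin x (k l : R) (u v w : R -> R) (u' v' w' : R) :
  is_derive x 1 u u' -> is_derive x 1 v v' -> is_derive x 1 w w' ->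
  is_derive x 1 (fun x => k * u x + l * v x + w x) (k * u' + l * v' + w').
Proof.
move=> du dv dw.
exact: (is_deriveD (is_deriveD (is_deriveZ k du) (is_deriveZ l dv)) dw).
Qed.

Lemma cderiv_lin a b c f g f' g' : cderiv a b f g -> cderiv a b f' g' ->
  cderiv a b (fun x => c * f x + f' x) (fun x => c * g x + g' x).
Proof.
have ReE h h' : (fun x : R => complex.Re (c * h x + h' x)) =
    (fun x => complex.Re c * complex.Re (h x) + - complex.Im c * complex.Im (h x)
              + complex.Re (h' x)).
  by apply/funext => x; rewrite ReD ReM mulNr.
have ImE h h' : (fun x : R => complex.Im (c * h x + h' x)) =
    (fun x => complex.Re c * complex.Im (h x) + complex.Im c * complex.Re (h x)
              + complex.Im (h' x)).
  by apply/funext => x; rewrite ImD ImM.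
move=> [h1 h2 h3 h4] [k1 k2 k3 k4]; split.
- by rewrite ReE; exact: within_continuous_lin.
- by rewrite ImE; exact: within_continuous_lin.
- move=> x xab; rewrite ReE ReD ReM -mulNr.
  by apply: is_derive_lin; [exact: h3|exact: h4|exact: k3].
- move=> x xab; rewrite ImE ImD ImM.
  by apply: is_derive_lin; [exact: h4|exact: h3|exact: k4].
Qed.

Lemma cderiv_sum a b n (c : 'I_n -> R[i]) (F G : 'I_n -> R -> R[i]) :
  (forall i, cderiv a b (F i) (G i)) ->
  cderiv a b (fun x => \sum_i c i * F i x) (fun x => \sum_i c i * G i x).
Proof.
move=> FG; elim: (index_enum _) => [|i s IHs].
  under [X in cderiv _ _ X _]eq_fun do rewrite big_nil.
  under [X in cderiv _ _ _ X]eq_fun do rewrite big_nil.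
  by split=> [x|x|x _|x _]; [exact: cvg_cst|exact: cvg_cst|exact: is_derive_cst|
    exact: is_derive_cst].
under [X in cderiv _ _ X _]eq_fun do rewrite big_cons.
under [X in cderiv _ _ _ X]eq_fun do rewrite big_cons.
exact: cderiv_lin.
Qed.

(** Gronwall's argument applies to the energy [E], the sum of the squared moduli of [f] and [f1]. *)
Lemma cderiv_unique a b lam f f1 :
  cderiv a b f f1 -> cderiv a b f1 (fun x => lam * f x) ->
  (f a = 0 /\ f1 a = 0) \/ (f b = 0 /\ f1 b = 0) ->
  forall x, x \in `[a, b] -> f x = 0 /\ f1 x = 0.
Proof.
move=> [c1 c2 d1 d2] [c3 c4 d3 d4] end0.
pose p x := complex.Re (f x); pose q x := complex.Im (f x).
pose p1 x := complex.Re (f1 x); pose q1 x := complex.Im (f1 x).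
pose l := complex.Re lam; pose k := complex.Im lam.
pose E x := p x * p x + q x * q x + (p1 x * p1 x + q1 x * q1 x).
pose dE x := 2 * (p x * p1 x + q x * q1 x + p1 x * (l * p x - k * q x)
   + q1 x * (l * q x + k * p x)).
have E_ge0 x : 0 <= E x.
  by rewrite /E !addr_ge0 // -expr2 sqr_ge0.
have cE : {within `[a, b], continuous E}.
  move=> x; apply: cvgD; apply: cvgD; apply: cvgM;
    by [exact: c1|exact: c2|exact: c3|exact: c4].
have dE1 x : x \in `]a, b[ -> is_derive x 1 E (dE x).
  move=> xab; have e1 := d1 _ xab; have e2 := d2 _ xab.
  have := d3 _ xab; have := d4 _ xab; rewrite ReM ImM => e4 e3.
  have := is_deriveD (is_deriveD (is_deriveM e1 e1) (is_deriveM e2 e2))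
           (is_deriveD (is_deriveM e3 e3) (is_deriveM e4 e4)).
  move=> /is_derive_eq; apply.
  by rewrite /dE /p /q /p1 /q1 /l /k /GRing.scale /=; lra.
pose C := 2 + l ^+ 2 + k ^+ 2.
have dEC x : x \in `]a, b[ -> `|dE x| <= C * E x.
  move=> _; rewrite ler_norml /dE /E /C.
  move: (p x) (q x) (p1 x) (q1 x) => P Q P1 Q1.
  have s1 := sqr_ge0 (P + P1); have s2 := sqr_ge0 (P - P1).
  have s3 := sqr_ge0 (Q + Q1); have s4 := sqr_ge0 (Q - Q1).
  have s5 := sqr_ge0 (P1 + (l * P - k * Q)); have s6 := sqr_ge0 (P1 - (l * P - k * Q)).
  have s7 := sqr_ge0 (Q1 + (l * Q + k * P)); have s8 := sqr_ge0 (Q1 - (l * Q + k * P)).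
  have s9 : 0 <= (l ^+ 2 + k ^+ 2) * (P1 * P1 + Q1 * Q1).
    by rewrite mulr_ge0 ?addr_ge0 ?sqr_ge0 // -expr2 sqr_ge0.
  have s0 := sqr_ge0 P; have s0' := sqr_ge0 Q.
  by apply/andP; split; nra.
have E0 : E a = 0 \/ E b = 0.
  by case: end0 => -[h h1]; [left|right]; rewrite /E /p /q /p1 /q1 h h1 /= !mulr0 !addr0.
move=> x xab; have /eqP := gronwall0 cE dE1 dEC (fun y _ => E_ge0 y) E0 xab.
rewrite /E paddr_eq0 ?addr_ge0 -?expr2 ?sqr_ge0 // => /andP[/eqP h /eqP h1].
by split; exact: complex0P.
Qed.

Lemma ac_deriv_cderiv a b f g : a < b -> ac_deriv a b f g ->
  {within `[a, b], continuous (fun x => complex.Re (g x))} ->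
  {within `[a, b], continuous (fun x => complex.Im (g x))} -> cderiv a b f g.
Proof.
move=> ab [[iR iI] fE] cR cI.
have fR x : x \in `[a, b] -> complex.Re (f x) = complex.Re (f a) +
    \int[mu]_(t in `[a, x]) complex.Re (g t).
  by move=> xab; rewrite {1}fE // ReD.
have fI x : x \in `[a, b] -> complex.Im (f x) = complex.Im (f a) +
    \int[mu]_(t in `[a, x]) complex.Im (g t).
  by move=> xab; rewrite {1}fE // ImD.
split; [exact: primitive_continuous iR fR|exact: primitive_continuous iI fI| |].
- exact: (primitive_derive ab cR fR).
- exact: (primitive_derive ab cI fI).
Qed.

Lemma ac_deriv_continuous a b f g : a < b -> ac_deriv a b f g ->
  {within `[a, b], continuous (fun x => complex.Re (f x))} /\
  {within `[a, b], continuous (fun x => complex.Im (f x))}.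
Proof.
move=> ab [[iR iI] fE]; split.
- by apply: (primitive_continuous ab iR) => x xab; rewrite {1}fE // ReD.
- by apply: (primitive_continuous ab iI) => x xab; rewrite {1}fE // ImD.
Qed.

Lemma ae_eq_Rintegral a b (u v : R -> R) : 
  mu.-integrable `[a, b] (EFin \o u) -> mu.-integrable `[a, b] (EFin \o v) ->
  {ae mu, forall x, x \in `[a, b] -> u x = v x} ->
  forall x, x \in `[a, b] ->
  \int[mu]_(t in `[a, x]) u t = \int[mu]_(t in `[a, x]) v t.
Proof.
move=> iu iv uv x; rewrite in_itv /= => /andP[ax xb].
have sub : `[a, x] `<=` `[a, b] by apply: subset_itvl; rewrite bnd_simp.
rewrite /Rintegral; congr fine; apply: ae_eq_integral => //.
- by apply: measurable_funS sub _ => //; exact: measurable_int iu.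
- by apply: measurable_funS sub _ => //; exact: measurable_int iv.
- apply: (@filterS _ _ (ae_filter_ringOfSetsType mu) _ _ _ uv) => y uvy yax /=.
  rewrite uvy //.
  exact: sub.
Qed.

(** Bootstrap: [f] is continuous, so [- lam * f] is a continuous representative of the weak
    derivative [f2]. Substituted under the integral, it makes [f1] differentiable in the classical
    sense. *)
Lemma H2_cderiv a b lam f f1 f2 : a < b -> H2 a b f f1 f2 ->
  {ae mu, forall x, x \in `[a, b] -> lam * f x = - f2 x} ->
  cderiv a b f f1 /\ cderiv a b f1 (fun x => - lam * f x).
Proof.
move=> ab [ff1 f1f2 _] flam.
have [cfR cfI] := ac_deriv_continuous ab ff1.
have [cf1R cf1I] := ac_deriv_continuous ab f1f2.
have cc : cderiv a b f f1 by exact: ac_deriv_cderiv.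
split => //.
have c0 : {within `[a, b], continuous (fun=> 0 : R)} by move=> x; exact: cvg_cst.
have cR : {within `[a, b], continuous (fun x => complex.Re (- lam * f x))}.
  have -> : (fun x => complex.Re (- lam * f x)) = (fun x => complex.Re (- lam) *
      complex.Re (f x) + - complex.Im (- lam) * complex.Im (f x) + 0).
    by apply/funext => x; rewrite addr0 mulNr -ReM.
  exact: within_continuous_lin cfR cfI c0.
have cI : {within `[a, b], continuous (fun x => complex.Im (- lam * f x))}.
  have -> : (fun x => complex.Im (- lam * f x)) = (fun x => complex.Re (- lam) *
      complex.Im (f x) + complex.Im (- lam) * complex.Re (f x) + 0).
    by apply/funext => x; rewrite addr0 -ImM.
  exact: within_continuous_lin cfI cfR c0.
have iR : mu.-integrable `[a, b] (EFin \o fun x => complex.Re (- lam * f x)).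
  by apply: continuous_compact_integrable => //; exact: segment_compact.
have iI : mu.-integrable `[a, b] (EFin \o fun x => complex.Im (- lam * f x)).
  by apply: continuous_compact_integrable => //; exact: segment_compact.
apply: ac_deriv_cderiv => //; split; first by split.
have [[i2R i2I] f1E] := f1f2 => x xab.
rewrite f1E //; congr (_ + _); rewrite /cintegral.
by congr (_ +i* _); apply: (ae_eq_Rintegral _ _ _ xab) => //;
  apply: (@filterS _ _ (ae_filter_ringOfSetsType mu) _ _ _ flam) => y fy yab;
  rewrite mulNr fy // opprK.
Qed.
End ComplexDerivative.

(** * The quotient space and the circle *)

Section Quotient.
Variables (R : realType) (G : metricGraph R).

Lemma glueP (p q : edges_space G) :
  \pi_(graph_space G) p = \pi_(graph_space G) q <-> Defs.glue p q.
Proof.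
split; first by move=> /eqquotP /asboolP.
by move=> pq; apply/eqquotP/asboolP.
Qed.

Lemma glue_repr (p : edges_space G) : Defs.glue p (repr (\pi_(graph_space G) p)).
Proof. by apply/glueP; rewrite reprK. Qed.

(** If no vertex joined [Z] to its complement, the image of the edges of [Z] in the quotient would
    be open and closed, nonempty and proper. *)
Lemma connected_vrel (Z : {set edge G}) : connected [set: graph_space G] ->
  Z != finset.set0 -> Z != [set: edge G]%SET ->
  exists s t, [/\ vrel G s t, s.1 \in Z & t.1 \notin Z].
Proof.
move=> conn Z0 ZT; apply: contrapT => nst.
have vrZ s t : vrel G s t -> s.1 \in Z -> t.1 \in Z.
  by move=> st sZ; apply: contrapT => /negP tZ; apply: nst; exists s, t.
have vsym s t : vrel G s t -> vrel G t s.
  move=> st; have [_ /(_ st) <-] := vrel_equiv s t s.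
  by have [] := vrel_equiv s s s.
have glZ p q : Defs.glue p q -> (projT1 p \in Z) = (projT1 q \in Z).
  case=> [->//|[s [t [-> -> st]]]] /=; apply/idP/idP; first exact: vrZ.
  by apply: vrZ; exact: vsym.
(* The choice of representative is harmless, since by [glZ] gluing preserves membership of the edge
   in [Z]. *)
pose A : set (graph_space G) := [set q | projT1 (repr q) \in Z].
have openZ (P : pred (edge G)) : open [set p : edges_space G | P (projT1 p)].
  apply/sigT_openP => e; have [Pe|Pe] := boolP (P e).
    by rewrite (_ : _ @^-1` _ = setT); [exact: openT|apply/seteqP; split].
  rewrite (_ : _ @^-1` _ = set0); first exact: open0.
  by apply/seteqP; split => x //=; rewrite (negbTE Pe).
have piA : (\pi_(graph_space G) @^-1` A) = [set p : edges_space G | projT1 p \in Z].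
  by apply/seteqP; split => p /=; rewrite /A /= -(glZ _ _ (glue_repr p)).
have oA : open A.
  suff : open (\pi_(graph_space G) @^-1` A) by [].
  by rewrite piA; exact: (openZ (mem Z)).
have cA : closed A.
  rewrite -openC; suff : open (~` (\pi_(graph_space G) @^-1` A)) by [].
  rewrite piA.
  rewrite (_ : ~` _ = [set p : edges_space G | projT1 p \notin Z]);
    first exact: (openZ (fun e => e \notin Z)).
  by apply/seteqP; split => p /= /negP.
have := conn A; rewrite -{1}(setTI A) => AT.
have {}AT : A = setT.
  apply: AT; last by exists A; rewrite ?setTI.
    have [e eZ] := set0Pn _ Z0.
    exists (\pi_(graph_space G) (endpoint_pt (e, false))).
    by rewrite setTI /A /= -(glZ _ _ (glue_repr _)).
  by exists A; rewrite ?setTI.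
case/negP: ZT; apply/eqP/setP => e; rewrite finset.in_setT.
have : A (\pi_(graph_space G) (endpoint_pt (e, false))) by rewrite AT.
by rewrite /A /= -(glZ _ _ (glue_repr _)).
Qed.
End Quotient.

(** * Parametrisation of the circle by the unit interval *)

Section Wrap.
Variable R : realType.
Implicit Types t u : R.

Definition wrap t : R * R := (cos (t * (pi *+ 2)), sin (t * (pi *+ 2))).

Lemma wrap_circle t : (wrap t).1 ^+ 2 + (wrap t).2 ^+ 2 = 1.
Proof. exact: cos2Dsin2. Qed.

Lemma wrap_continuous : continuous wrap.
Proof.
move=> t; have h : (fun u => u * (pi *+ 2)) @ t --> t * (pi *+ 2).
  by apply: cvgM; [exact: cvg_id|exact: cvg_cst].
have hc : (fun u => cos (u * (pi *+ 2))) @ t --> cos (t * (pi *+ 2)).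
  exact: (continuous_comp h (@continuous_cos R _)).
have hs : (fun u => sin (u * (pi *+ 2))) @ t --> sin (t * (pi *+ 2)).
  exact: (continuous_comp h (@continuous_sin R _)).
exact: (cvg_pair hc hs).
Qed.

Lemma wrap01 : wrap 1 = wrap 0.
Proof. by rewrite /wrap mul1r mul0r cos2pi sin2pi cos0 sin0. Qed.

(** With [d] equal to [(u - t) * pi], equal images give [cos (d *+ 2) = 1], hence [sin d = 0], which
    is impossible for [0 < u - t < 1]. *)
Lemma wrap_inj t u : t <= u -> 0 <= t -> u <= 1 -> wrap t = wrap u ->
  t = u \/ t = 0 /\ u = 1.
Proof.
move=> tu t0 u1 [ct st].
have [->|d0] := eqVneq t u; [by left|right].
suff : ~ u - t < 1 by lra.
move=> d1; set d := (u - t) * pi.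
have : cos (d *+ 2) = 1.
  have -> : d *+ 2 = u * (pi *+ 2) - t * (pi *+ 2) by rewrite /d -mulrnAr mulrBl.
  by rewrite cosB -ct -st -!expr2 cos2Dsin2.
have : 0 < sin d.
  have p0 := pi_gt0 R.
  apply: sin_gt0_pi; rewrite /d; apply/andP; split.
    by apply: mulr_gt0 => //; rewrite subr_gt0 lt_neqAle d0.
  by rewrite -[ltRHS]mul1r ltr_pM2r.
rewrite cos_mulr2n cos2sin2 => /(exprn_gt0 2) s0.
by rewrite mulr2n; lra.
Qed.

(** The angle is [acos x] on the closed upper half and [2 pi - acos x] on the lower one, where
    [y < 0] excludes a full turn. *)
Lemma wrap_surj (z : R * R) : z.1 ^+ 2 + z.2 ^+ 2 = 1 ->
  exists t, [/\ 0 <= t, t < 1 & wrap t = z].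
Proof.
case: z => x y /= xy.
have p0 := pi_gt0 R.
have x1 : -1 <= x <= 1.
  by have := sqr_ge0 y; move=> ?; apply/andP; split; nra.
have sa : sin (acos x) = `|y|.
  by rewrite sin_acos // -xy addrC addKr sqrtr_sqr.
have ca : cos (acos x) = x by rewrite acosK // in_itv.
have a0 := acos_ge0 x1; have api := acos_lepi x1.
have p20 : 0 < pi *+ 2 :> R by rewrite pmulrn_lgt0.
have scale (s : R) : s / (pi *+ 2) * (pi *+ 2) = s by rewrite divfK // gt_eqF.
have [y0|y0] := leP 0 y.
  exists (acos x / (pi *+ 2)); split.
  - by rewrite divr_ge0 // ltW.
  - by rewrite ltr_pdivrMr // mul1r mulr2n; lra.
  - by rewrite /wrap scale ca sa ger0_norm.
exists ((pi *+ 2 - acos x) / (pi *+ 2)); split.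
- by apply: divr_ge0; [rewrite mulr2n; lra|exact: ltW].
- rewrite ltr_pdivrMr // mul1r ltrBlDr ltrDl lt_neqAle a0 andbT eq_sym.
  apply/eqP => ax0; move: sa; rewrite ax0 sin0 => /esym/eqP.
  by rewrite normr_eq0 lt_eqF.
- rewrite /wrap scale addrC cosD2pi sinD2pi cosN sinN ca sa ltr0_norm //.
  by rewrite opprK.
Qed.
End Wrap.

(** * Compactness and the passage to a homeomorphism *)

Lemma compact_set_type (T : topologicalType) (A : set T) :
  compact A -> compact [set: set_type A].
Proof.
move=> cA; have [->|/set0P[a Aa]] := eqVneq A set0.
  move=> F FF _; suff : False by [].
  by have [[x xA] _] := @filter_ex _ F FF setT filterT; move: xA; rewrite inE.
pose a0 : set_type A := SigSub (mem_set Aa).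
(* A left inverse of the inclusion, continuous within [A]; its value [a0] off [A] is arbitrary. The
   subtype is the image of [A] under it. *)
pose f (x : T) : set_type A := insubd a0 x.
have fE (y : set_type A) : f (set_val y) = y by rewrite set_valE /f valKd.
have cf : {within A, continuous f}.
  apply/subspace_sigL_continuousP.
  have -> : sigL A f = id by apply/funext => y; rewrite /sigL /= fE.
  by move=> x; exact: cvg_id.
have := continuous_compact cf cA; congr compact.
by apply/seteqP; split => // y _; exists (set_val y); [exact: set_valP|exact: fE].
Qed.

Lemma compact_graph_space (R : realType) (G : metricGraph R) :
  compact [set: graph_space G].
Proof.
have cE : compact [set: edges_space G].
  apply: sigT_compact; first exact: finite_finset.
  by move=> e; apply: compact_set_type; exact: segment_compact.
have -> : [set: graph_space G] = \pi_(graph_space G) @` [set: edges_space G].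
  by apply/seteqP; split => // q _; exists (repr q) => //; rewrite reprK.
apply: continuous_compact cE; apply: continuous_subspaceT.
exact: pi_continuous.
Qed.

(** A continuous bijection from a compact space to a Hausdorff space maps closed sets to closed
    sets, so its inverse is continuous. *)
Lemma homeomorphic_circle (R : realType) (T : topologicalType) (f : T -> R * R) :
  compact [set: T] -> continuous f -> injective f ->
  (forall x, (f x).1 ^+ 2 + (f x).2 ^+ 2 = 1) ->
  (forall z, z.1 ^+ 2 + z.2 ^+ 2 = 1 -> exists x, f x = z) ->
  homeomorphic T (circle R).
Proof.
move=> cT cf f_inj fS f_surj.
have /choice[g fgK] (z : circle R) : exists x, f x = set_val z.
  by apply: f_surj; exact: (set_valP z).
pose h x : circle R := SigSub (mem_set (fS x : [set z : R * R | _] (f x))).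
have hE x : set_val (h x) = f x by [].
exists h, g; split.
- by move=> x; apply: f_inj; rewrite fgK hE.
- by move=> z; apply: val_inj; rewrite -!set_valE hE fgK.
- exact: (@continuous_comp_initial _ _ _ set_val h).
- apply/continuous_closedP => A cA.
  have -> : g @^-1` A = set_val @^-1` (f @` A).
    apply/seteqP; split => z /=; first by move=> Az; exists (g z).
    by case=> x Ax fx; suff -> : g z = x by []; apply: f_inj; rewrite fgK.
  apply: closed_comp => [z _|]; first exact: initial_continuous.
  apply: compact_closed; first exact: norm_hausdorff.
  apply: continuous_compact; first exact: continuous_subspaceT.
  exact: subclosed_compact cT _.
Qed.

(** * Affine coordinates on an edge *)

Section EdgeCoordinate.
Variables (R : realType) (G : metricGraph R).
Implicit Types (e : edge G) (b : bool) (x : R).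

(** Runs from 0 at the end [b] to 1 at the other end, so that [b] chooses the direction of
    traversal. *)
Definition edge_coord e b x :=
  (x - endpt e b) / (endpt e (~~ b) - endpt e b).

Lemma endpt_neq e b : endpt e (~~ b) - endpt e b != 0.
Proof.
by rewrite subr_eq0; case: b => /=; [rewrite lt_eqF|rewrite gt_eqF]; rewrite ?endpt_lt.
Qed.

Lemma edge_coord_continuous e b : continuous (edge_coord e b).
Proof.
move=> x; apply: cvgM; last exact: cvg_cst.
by apply: cvgB; [exact: cvg_id|exact: cvg_cst].
Qed.

Lemma edge_coord01 e b x : edge_set e x -> 0 <= edge_coord e b x <= 1.
Proof.
rewrite /edge_set /= in_itv /= => /andP[ax xb]; have lt := endpt_lt e.
rewrite /edge_coord; case: b => /=.
  rewrite -[_ - endpt e true]opprB -[endpt e false - _]opprB mulNr invrN mulrN opprK.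
  by rewrite divr_ge0 ?subr_ge0 ?(ltW lt) //= ler_pdivrMr ?subr_gt0 // mul1r lerB.
by rewrite divr_ge0 ?subr_ge0 ?(ltW lt) //= ler_pdivrMr ?subr_gt0 // mul1r lerB.
Qed.

Lemma edge_coord_inj e b : injective (edge_coord e b).
Proof.
move=> x y; rewrite /edge_coord => /mulIf => /(_ (invr_neq0 (endpt_neq e b))).
exact: addIr.
Qed.

Lemma edge_coord_start e b : edge_coord e b (endpt e b) = 0.
Proof. by rewrite /edge_coord subrr mul0r. Qed.

Lemma edge_coord_finish e b : edge_coord e b (endpt e (~~ b)) = 1.
Proof. by rewrite /edge_coord divff // endpt_neq. Qed.

Definition point_val (p : edges_space G) : R := set_val (projT2 p).

Lemma point_val_in (p : edges_space G) : edge_set (projT1 p) (point_val p).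
Proof. exact: set_valP (projT2 p). Qed.

Lemma point_eq (p q : edges_space G) :
  projT1 p = projT1 q -> point_val p = point_val q -> p = q.
Proof.
case: p q => e x [f y] /= ef; case: _ / ef y => y; rewrite /point_val /= => xy.
by congr existT; apply: val_inj; rewrite -!set_valE.
Qed.

Lemma point_val_endpoint (s : endpoint G) : point_val (endpoint_pt s) = endpt s.1 s.2.
Proof. by rewrite /point_val /= set_valE. Qed.

End EdgeCoordinate.

(** * Homeomorphism of a cyclically ordered graph with the circle *)

Section CycleHomeomorphic.
Variables (R : realType) (G : metricGraph R) (n : nat).
Variables (idx : edge G -> nat) (side : edge G -> bool).
Hypothesis idx_inj : injective idx.
Hypothesis idx_lt : forall e, (idx e < n)%N.
Hypothesis idx_surj : forall k, (k < n)%N -> exists e, idx e = k.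
Hypothesis idx_vrel : forall e f, idx f = ((idx e).+1 %% n)%N ->
  vrel G (e, ~~ side e) (f, side f).
Hypothesis vrel_idx : forall s t, vrel G s t -> s = t \/
  exists e f, idx f = ((idx e).+1 %% n)%N /\
   (s = (e, ~~ side e) /\ t = (f, side f) \/
    t = (e, ~~ side e) /\ s = (f, side f)).

Let coord (p : edges_space G) := edge_coord (projT1 p) (side (projT1 p)) (point_val p).
(** The edge of index [k] fills the interval from [k / n] to [(k + 1) / n]. *)
Let pos (p : edges_space G) : R := ((idx (projT1 p))%:R + coord p) / n%:R.
Let F (p : edges_space G) : R * R := wrap (pos p).

Let coord01 p : 0 <= coord p <= 1.
Proof. exact: edge_coord01 (point_val_in p). Qed.

Let n_gt0 (e : edge G) : 0 < n%:R :> R.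
Proof. by rewrite ltr0n; apply: leq_trans (idx_lt e). Qed.

Let pos01 p : 0 <= pos p <= 1.
Proof.
have n0 := n_gt0 (projT1 p); have /andP[c0 c1] := coord01 p.
rewrite /pos divr_ge0 ?addr_ge0 ?ler0n //= ler_pdivrMr // mul1r.
have : (idx (projT1 p)).+1%:R <= n%:R :> R by rewrite ler_nat.
by rewrite -natr1; lra.
Qed.

Let F_continuous : continuous F.
Proof.
apply: (@sigT_continuous _ (fun e => edge_space e) _ (fun e y => wrap
  (((idx e)%:R + edge_coord e (side e) (set_val y)) / n%:R))).
move=> e y.
have c1 : (fun y : edge_space e => edge_coord e (side e) (set_val y)) @ y -->
    edge_coord e (side e) (set_val y).
  apply: (@continuous_comp _ _ _ (set_val : edge_space e -> R)).
    exact: initial_continuous.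
  exact: edge_coord_continuous.
have c2 : (fun y : edge_space e =>
    ((idx e)%:R + edge_coord e (side e) (set_val y)) / n%:R) @ y -->
    ((idx e)%:R + edge_coord e (side e) (set_val y)) / n%:R.
  exact: (cvgM (cvgD (cvg_cst _) c1) (cvg_cst _)).
exact: (continuous_comp c2 (@wrap_continuous R _)).
Qed.

Let coord0 p : coord p = 0 -> p = endpoint_pt (projT1 p, side (projT1 p)).
Proof.
move=> c0; apply: point_eq => //; rewrite point_val_endpoint /=.
by apply: (@edge_coord_inj _ _ (projT1 p) (side (projT1 p))); rewrite edge_coord_start.
Qed.

Let coord1 p : coord p = 1 -> p = endpoint_pt (projT1 p, ~~ side (projT1 p)).
Proof.
move=> c1; apply: point_eq => //; rewrite point_val_endpoint /=.
by apply: (@edge_coord_inj _ _ (projT1 p) (side (projT1 p))); rewrite edge_coord_finish.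
Qed.

Let F_vrel e f : idx f = ((idx e).+1 %% n)%N ->
  F (endpoint_pt (e, ~~ side e)) = F (endpoint_pt (f, side f)).
Proof.
move=> ef; rewrite /F /pos /coord !point_val_endpoint /=.
rewrite edge_coord_finish edge_coord_start addr0 natr1 ef.
have n0 := n_gt0 e.
(* From the last edge to the first the position jumps from 1 to 0, which [wrap] identifies. *)
have := idx_lt e; rewrite leq_eqVlt => /predU1P[en|en].
  by rewrite en modnn mul0r divff ?wrap01 // gt_eqF.
by rewrite modn_small.
Qed.

Let F_glue p q : Defs.glue p q -> F p = F q.
Proof.
case=> [->//|[s [t [-> -> /vrel_idx[->//|[e [f [ef [[-> ->]|[-> ->]]]]]]]]]].
  exact: F_vrel.
by rewrite (F_vrel ef).
Qed.

Let glue_succ p q : coord p = 1 -> coord q = 0 ->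
  idx (projT1 q) = ((idx (projT1 p)).+1 %% n)%N -> Defs.glue p q.
Proof.
move=> p1 q0 pq; right; exists (projT1 p, ~~ side (projT1 p)).
exists (projT1 q, side (projT1 q)); split; [exact: coord1|exact: coord0|].
exact: idx_vrel.
Qed.

Let glue_sym (p q : edges_space G) : Defs.glue p q -> Defs.glue q p.
Proof. by move=> /glueP h; apply/glueP. Qed.

Let F_inj_le p q : pos p <= pos q -> F p = F q -> Defs.glue p q.
Proof.
move=> pq Fpq; have n0 := n_gt0 (projT1 p).
have /andP[p0 _] := pos01 p; have /andP[_ q1] := pos01 q.
have /andP[cp0 cp1] := coord01 p; have /andP[cq0 cq1] := coord01 q.
have lt_q : (idx (projT1 q))%:R + 1 <= n%:R :> R by rewrite natr1 ler_nat.
have mulE (u : R) : u / n%:R * n%:R = u by rewrite divfK // gt_eqF.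
(* In the exceptional case [q] finishes the last edge and [p] starts the first one. *)
have [h|[h0 h1]] := wrap_inj pq p0 q1 Fpq; last first.
  apply: glue_sym; move/(congr1 (fun u => u * n%:R)): h1; rewrite mulE mul1r => h1.
  move/(congr1 (fun u => u * n%:R)): h0; rewrite mulE mul0r => h0.
  have p_ge0 : 0 <= (idx (projT1 p))%:R :> R by rewrite ler0n.
  have ip : (idx (projT1 p))%:R = 0%:R :> R by lra.
  have iq : (idx (projT1 q)).+1%:R = n%:R :> R by rewrite -natr1; lra.
  move/eqP: ip; rewrite eqr_nat => /eqP ip.
  move/eqP: iq; rewrite eqr_nat => /eqP iq.
  apply: glue_succ; rewrite ?iq ?modnn //.
  - by move: h1; rewrite -[in X in _ = X]iq -natr1; lra.
  - by move: h0; rewrite ip; lra.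
move/(congr1 (fun u => u * n%:R)): h; rewrite !mulE => h.
(* Coordinates lie between 0 and 1, so equal positions on different edges occur only at the junction
   of two consecutive ones. *)
have key p' q' : (idx (projT1 p') < idx (projT1 q'))%N ->
    (idx (projT1 p'))%:R + coord p' = (idx (projT1 q'))%:R + coord q' ->
    Defs.glue p' q'.
  move=> lt e.
  have /andP[cp0' cp1'] := coord01 p'; have /andP[cq0' cq1'] := coord01 q'.
  have le1 : (idx (projT1 p'))%:R + 1 <= (idx (projT1 q'))%:R :> R.
    by rewrite natr1 ler_nat.
  apply: glue_succ; [lra|lra|].
  have : (idx (projT1 q'))%:R = (idx (projT1 p')).+1%:R :> R by rewrite -natr1; lra.
  move/eqP; rewrite eqr_nat => /eqP iq.
  by rewrite modn_small -?iq.
have [lt|lt|/idx_inj eq] := ltngtP (idx (projT1 p)) (idx (projT1 q)).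
- exact: key.
- by apply: glue_sym; apply: key.
left; apply: point_eq => //; move: h; rewrite /coord -eq => /addrI.
exact: edge_coord_inj.
Qed.

Let F_inj p q : F p = F q -> Defs.glue p q.
Proof.
move=> Fpq; have [pq|/ltW qp] := leP (pos p) (pos q); first exact: F_inj_le.
by apply: glue_sym; apply: F_inj_le.
Qed.

Let F_surj (e0 : edge G) (z : R * R) : z.1 ^+ 2 + z.2 ^+ 2 = 1 -> exists p, F p = z.
Proof.
move=> /wrap_surj[t [t0 t1 <-]]; have n0 := n_gt0 e0.
(* The integer part of [t * n] selects the edge, the fractional part the point on it. *)
pose k := Num.truncn (t * n%:R).
have tn0 : 0 <= t * n%:R by rewrite mulr_ge0 // ltW.
have /andP[k1 k2] : (k%:R <= t * n%:R < k.+1%:R) by exact: truncn_itv.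
have kn : (k < n)%N.
  rewrite -(ltr_nat R); apply: le_lt_trans k1 _.
  by rewrite -[ltRHS]mul1r ltr_pM2r.
have [e ek] := idx_surj kn.
pose b := side e; pose c := t * n%:R - k%:R.
pose x := endpt e b + c * (endpt e (~~ b) - endpt e b).
have [c0 c1] : 0 <= c /\ c <= 1 by rewrite /c; move: k2; rewrite -natr1; split; lra.
have xe : edge_set e x.
  rewrite /edge_set /= in_itv /= /x; have lt := endpt_lt e.
  by case: (b) => /=; apply/andP; split; nra.
exists (existT (fun e => edge_space e) e (SigSub (mem_set xe))).
have xc : edge_coord e b x = c.
  by rewrite /edge_coord /x addrC addKr mulfK // endpt_neq.
rewrite /F /pos /coord /point_val /= set_valE /= xc ek /c.
by rewrite addrC subrK mulfK // gt_eqF.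
Qed.

(** [F] takes equal values exactly at glued points, so it descends to an injective map on the
    quotient, written [F \o repr]. *)
Lemma cycle_homeomorphic (e0 : edge G) : homeomorphic (graph_space G) (circle R).
Proof.
have F_pi : {homo F : p q / \pi_(graph_space G) p == \pi_(graph_space G) q >-> p == q}.
  by move=> p q /eqP/glueP/F_glue ->.
have F_repr p : F (repr (\pi_(graph_space G) p)) = F p.
  by rewrite -(F_glue (glue_repr p)).
apply: (@homeomorphic_circle _ _ (F \o repr : graph_space G -> R * R)).
- exact: compact_graph_space.
- exact: repr_comp_continuous F_continuous F_pi.
- by move=> p q /F_inj /glueP; rewrite !reprK.
- by move=> p; exact: wrap_circle.
- move=> z /(F_surj e0)[p <-]; exists (\pi_(graph_space G) p).
  by rewrite /= F_repr.
Qed.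
End CycleHomeomorphic.

(** * Counting eigenfunctions *)

Section Eigenfunctions.
Variables (R : realType) (G : metricGraph R) (D : {set {set endpoint G}}).
Variables (lam : R[i]) (m : nat) (F f1 f2 : 'I_m -> edge_fun G).
Hypothesis FH2 : forall i e,
  H2 (endpt e false) (endpt e true) (F i e) (f1 i e) (f2 i e).
Hypothesis F_cont : forall i s t, vrel G s t -> endval (F i) s = endval (F i) t.
Hypothesis F_dirichlet :
  forall i v, v \in D -> forall s, s \in v -> endval (F i) s = 0.
Hypothesis F_kirchhoff : forall i v, v \in vertices G -> v \notin D ->
  \sum_(s in v) ingoing (f1 i) s = 0.
Hypothesis F_eigen :
  forall i, eq_L2 (fun e x => lam * F i e x) (fun e x => - f2 i e x).
Hypothesis F_indep : lin_indep F.
Hypothesis D_pendant : D \subset pendant G.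

Let val (s : edge G * bool) : 'cV[R[i]]_m := \col_i endval (F i) s.
Let der (s : edge G * bool) : 'cV[R[i]]_m := \col_i ingoing (f1 i) s.
Let comb (H : 'I_m -> edge_fun G) (c : 'rV[R[i]]_m) : edge_fun G :=
  fun e x => \sum_i c 0 i * H i e x.

Let val0P c s : c *m val s = 0 <-> endval (comb F c) s = 0.
Proof.
have E : (c *m val s) 0 0 = endval (comb F c) s.
  by rewrite mxE; apply: eq_bigr => i _; rewrite mxE.
split=> [h|h]; first by rewrite -E h mxE.
by apply/matrixP => i j; rewrite !ord1 E h mxE.
Qed.

Let der0P c s : c *m der s = 0 <-> endval (comb f1 c) s = 0.
Proof.
have E : (c *m der s) 0 0 = ingoing (comb f1 c) s.
  transitivity (\sum_i c 0 i * ingoing (f1 i) s).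
    by rewrite mxE; apply: eq_bigr => i _; rewrite mxE.
  rewrite /ingoing /endval /comb; case: s.2 => //; rewrite -sumrN.
  by apply: eq_bigr => i _; rewrite mulrN.
have E' : (c *m der s = 0) <-> ingoing (comb f1 c) s = 0.
  split=> [h|h]; first by rewrite -E h mxE.
  by apply/matrixP => i j; rewrite !ord1 E h mxE.
rewrite E' /ingoing; case: s.2 => //; split => [/eqP|->]; last by rewrite oppr0.
by rewrite oppr_eq0 => /eqP.
Qed.

Let comb_zero c s : c *m val s = 0 -> c *m der s = 0 ->
  forall x, x \in `[endpt s.1 false, endpt s.1 true] ->
    comb F c s.1 x = 0 /\ comb f1 c s.1 x = 0.
Proof.
move=> /val0P v0 /der0P d0.
have H i := H2_cderiv (endpt_lt s.1) (FH2 i s.1) (F_eigen i s.1).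
(* The equation [- f2 = lam * f] becomes a first-order system with coefficient [- lam]. *)
apply: (@cderiv_unique _ _ _ (- lam)).
- exact: (cderiv_sum (fun i => c 0 i) (fun i => (H i).1)).
- have := cderiv_sum (fun i => c 0 i) (fun i => (H i).2).
  congr (cderiv _ _ _ _); apply/funext => x; rewrite /comb mulr_sumr.
  by apply: eq_bigr => i _; rewrite mulrCA.
- by move: v0 d0; rewrite /endval; case: s.2 => v0 d0; [right|left].
Qed.

Let endpt_itv (e : edge G) b : endpt e b \in `[endpt e false, endpt e true].
Proof. by rewrite in_itv /=; case: b; rewrite lexx ?andbT ltW ?endpt_lt. Qed.

Lemma card_eigenfunctions (e0 : edge G) :
  (forall Z : {set edge G}, Z != finset.set0 -> Z != [set: edge G]%SET ->
    exists s t, [/\ vrel G s t, s.1 \in Z & t.1 \notin Z]) ->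
  (exists2 v, v \in vertices G & #|v| != 2%N) ->
  m%:Z <= #|D|%:Z + #|(pendant G :\: D)%SET|%:Z + 2 * betti G - 1.
Proof.
move=> conn branch.
have D1 v : v \in D -> #|v| = 1%N.
  by move=> /(fintype.subsetP D_pendant); rewrite inE => /andP[_ /eqP].
have -> : #|D|%:Z + #|(pendant G :\: D)%SET|%:Z = #|pendant G|%:Z.
  by rewrite -(cardsID D (pendant G)) (finset.setIidPr _) // PoszD.
apply: (@forcing_bound _ _ (vrel G) m val der) => //.
- exact: vrel_equiv.
- move=> c s v0 d0; have z := comb_zero v0 d0 (endpt_itv s.1 (~~ s.2)).
  by split; [apply/val0P|apply/der0P]; case: z.
- by move=> s t st; apply/matrixP => i j; rewrite !mxE; exact: F_cont.
- move=> v vV v1; apply/matrixP => i j; rewrite summxE mxE.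
  under eq_bigr do rewrite mxE.
  by apply: F_kirchhoff => //; apply: contra v1 => /D1 ->.
- move=> v s vV v1 sv; have [vD|vD] := boolP (v \in D).
    by left; apply/matrixP => i j; rewrite !mxE; exact: (F_dirichlet _ vD).
  (* Outside [D] the Kirchhoff sum at a pendant vertex has a single term, which is the Neumann
     condition. *)
  right; apply/matrixP => i j; rewrite !mxE -(F_kirchhoff i vV vD).
  move/eqP/cards1P: v1 sv => [x ->]; rewrite finset.inE => /eqP ->.
  by rewrite big_set1.
(* A combination with zero Cauchy data at every end is zero on every edge, so independence makes its
   coefficients zero. *)
- move=> c c0; apply/matrixP => i j; rewrite ord1 mxE.
  apply: (@F_indep (fun j => c 0 j)) => e.
  apply: aeW => x xe.
  by have [v0 d0] := c0 (e, false); case: (comb_zero v0 d0 xe).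
Qed.
End Eigenfunctions.

Theorem proposition2p2 (R : realType) (G : metricGraph R)
    (D : {set {set endpoint G}}) (lam : R[i]) :
  connected [set: graph_space G] ->
  ~ homeomorphic (graph_space G) (circle R) ->
  D \subset pendant G ->
  is_eigenvalue D lam ->
  (multiplicity D lam <=
    ((#|D|%:Z + #|(pendant G :\: D)%SET|%:Z + 2 * betti G - 1)%:~R)%:E)%E.
Proof.
move=> conn not_circle D_pendant [f [_ f_neq0]].
(* Without edges every function would be zero; the eigenfunction [f] thus provides an edge to start
   from. *)
have [e0 _|no_edge] := pickP (edge G); last first.
  by exfalso; apply: f_neq0 => e; have := no_edge e.
have vconn Z := @connected_vrel _ _ Z conn.
(* The multiplicity is a supremum over finite independent families, so it suffices to bound the size
   of each. *)
apply: ub_ereal_sup => _ [m [F [F_eigen F_indep]] <-].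
rewrite lee_fin pmulrn ler_int.
have /choice[f1 /choice[f2 Ff]] := F_eigen.
suff branch : exists2 v, v \in vertices G & #|v| != 2%N.
  apply: (@card_eigenfunctions R G D lam m F f1 f2 _ _ _ _ _ F_indep D_pendant
    e0 vconn branch); by move=> i; case: (Ff i).
(* If all degrees were two, the graph would be a single cycle, hence a circle. *)
apply: contrapT => no_branch; apply: not_circle.
have card2 v : v \in vertices G -> #|v| = 2%N.
  by move=> vV; apply/eqP; apply: contrapT => /negP v2; apply: no_branch; exists v.
have [n [idx [side [idx_inj idx_lt idx_surj idx_vrel vrel_idx]]]] :=
  cycle_enum (@vrel_equiv R G) card2 vconn e0.
exact: (cycle_homeomorphic idx_inj idx_lt idx_surj idx_vrel vrel_idx e0).
Qed.
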